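(* Let $a\ge 1$ be an integer, let $n\ge 0$ be an integer, and let $x$ be a complex number. For each integer $m\ge 1$ put $$\lambda_{m}=\sum_{l=0}^{m}S(l+a,a)\,x^{m-l}\binom{m}{l}\binom{l+a}{a}^{-1},$$ where $S(\cdot,\cdot)$ denotes the Stirling numbers of the second kind. Then the generalized Bernoulli polynomial $B_n^{a}$ of order $a$ satisfies $$B_{n}^{a}(-x)=\sum_{k=0}^{n}(-1)^{k}\, k!\, \mathrm{B}_{n,k}(\lambda_1,\lambda_2,\ldots,\lambda_{n-k+1}),$$ where $\mathrm{B}_{n,k}$ denotes the (partial exponential) Bell polynomial.
   Context: The generalized Bernoulli polynomials $B_k^{a}$ of order $a$ (the superscript $a$ is an index, not a power) are defined by the exponential generating function $$\left(\frac{t}{e^{t}-1}\right)^{a}e^{-xt}=\sum_{k=0}^{\infty}\frac{B^{a}_{k}(-x)}{k!}t^{k},\qquad |t|<2\pi,$$ where $t/(e^t-1)$ is taken to be $1$ at $t=0$. The Bell polynomials are defined, for integers $n\ge k\ge 0$, by $$\mathrm{B}_{n,k}(\lambda_1,\lambda_2,\dotsc,\lambda_{n-k+1})=\sum \frac{n!}{\prod_{i=1}^{n-k+1}\ell_i!} \prod_{i=1}^{n-k+1}\Bigl(\frac{\lambda_i}{i!}\Bigr)^{\ell_i},$$ where the sum is over all sequences of nonnegative integers $\ell_1,\ell_2,\ldots,\ell_{n-k+1}$ with $\sum_{i} i\,\ell_i=n$ and $\sum_{i}\ell_i=k$. In particular $\mathrm{B}_{0,0}=1$ and $\mathrm{B}_{n,0}=0$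 for $n\ge 1$. The Stirling numbers of the second kind $S(n,k)$, for $n\ge k\ge 1$, are defined by $$\frac{(e^y-1)^k}{k!}=\sum_{n=k}^\infty S(n,k)\frac{y^n}{n!}.$$ Convention: $x^0=1$, including when $x=0$. *)

(* Defs.v *)
From HB Require Import structures.
From mathcomp Require Import all_boot all_order all_algebra.
From mathcomp Require Import all_classical all_reals all_analysis.
From mathcomp Require Import complex.

Set Implicit Arguments.
Unset Strict Implicit.
Unset Printing Implicit Defensive.

Import Order.TTheory GRing.Theory Num.Theory.
Import numFieldNormedType.Exports.

Local Open Scope ring_scope.
Local Open Scope complex_scope.
Local Open Scope classical_set_scope.

Definition cexp (R : realType) (z : R[i]) : R[i] :=
  (expR (complex.Re z))%:C *
  ((cos (complex.Im z))%:C + 'i%C * (sin (complex.Im z))%:C).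

(* Convergence in R[i] for the topology of its modulus, which the library
   attaches to R[i] seen as a numFieldType. *)
Definition ccvg (R : realType) (u : nat -> R[i]) (l : R[i]) : Prop :=
  (u : nat -> (R[i] : numFieldType)) @ \oo --> (l : (R[i] : numFieldType)).

(* t / (e^t - 1), with the removable singularity at 0 filled in. *)
Definition bernoulli_factor (R : realType) (t : R[i]) : R[i] :=
  if t == 0 then 1 else t / (cexp t - 1).

(* B is the family (k, z) |-> B_k^a(z) of generalized Bernoulli polynomials of
   order a: it is determined by its exponential generating function. *)
Definition is_generalized_bernoulli (R : realType) (a : nat)
    (B : nat -> R[i] -> R[i]) : Prop :=
  forall x t : R[i], `|t| < (2 * pi)%:C ->
  ccvg (fun N => \sum_(0 <= k < N) B k (- x) / (k`!)%:R * t ^+ k)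
       (bernoulli_factor t ^+ a * cexp (- (x * t))).

(* S n k is the Stirling number of the second kind S(n, k) for 1 <= k <= n; the
   other values of S are unconstrained.  Integrality is not presupposed. *)
Definition is_stirling2 (R : realType) (S : nat -> nat -> R[i]) : Prop :=
  forall (k : nat) (y : R[i]), (1 <= k)%N ->
  ccvg (fun N => \sum_(k <= n < N) S n k * (y ^+ n / (n`!)%:R))
       ((cexp y - 1) ^+ k / (k`!)%:R).

(* Partial exponential Bell polynomial B_{n,k}(lam 1, ..., lam (n - k + 1)), for
   k <= n.  The ordinal i stands for the index i + 1; bounding each exponent by n
   loses nothing, since the exponents sum to k <= n. *)
Definition bell (F : fieldType) (n k : nat) (lam : nat -> F) : F :=
  \sum_(l : {ffun 'I_(n - k + 1) -> 'I_n.+1}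
        | ((\sum_(i < n - k + 1) i.+1 * l i)%N == n) &&
          ((\sum_(i < n - k + 1) l i)%N == k))
    (n`!)%:R / (\prod_(i < n - k + 1) (l i)`!)%:R *
    \prod_(i < n - k + 1) (lam i.+1 / (i.+1`!)%:R) ^+ l i.

Definition bell_arg (F : fieldType) (S : nat -> nat -> F) (a : nat) (x : F)
    (m : nat) : F :=
  \sum_(0 <= l < m.+1)
    S (l + a)%N a * x ^+ (m - l) * ('C(m, l))%:R * (('C(l + a, a))%:R)^-1.

(* Main.v *)
Require Import Defs.
From HB Require Import structures.
From mathcomp Require Import all_boot all_order all_algebra.
From mathcomp Require Import all_classical all_reals all_analysis.
From mathcomp Require Import complex ring.
Import Order.TTheory GRing.Theory Num.Theory.
Local Open Scope ring_scope.
Local Open Scope complex_scope.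

Set Implicit Arguments.
Unset Strict Implicit.
Unset Printing Implicit Defensive.

(** Put w(t) = ((e^t - 1) / t)^a e^(x t).  Its coefficients, as an exponential
generating function, are the lambda_m with lambda_0 = 1, because
a! S(l + a, a) / (l + a)! is the coefficient of t^l in ((e^t - 1) / t)^a.  The
generating function of the B_k^a(-x) is 1 / w, and expanding
1 / (1 + (w - 1)) as the geometric series of (-1)^k (w - 1)^k gives the
formula: by the multinomial theorem the coefficient of t^n in (w - 1)^k is
k! / n! times the Bell polynomial B_{n,k}(lambda_1, lambda_2, ...).

The algebraic half ([coef_exp_bell], [coef_inverse_bell]) is carried out with
polynomials modulo X^(n+1); only the coefficients up to n of w and of its inverse
matter.

The analytic half has to turn the three convergent series into a congruence
between their truncations.  No product of series is ever formed: a convergent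
power series gives, for each N, an estimate f(t) = p(t) + O(t^N) as t tends to
0 from the right ([expands_series]), such estimates multiply ([expandsM]), and
each of them determines p modulo X^N ([expands_inj]).

For x complex the Taylor series of e^(x t) comes for free from the hypothesis on
Stirling numbers.  With k = 1 it says that e^y - 1 is the sum of some everywhere
convergent series in y; on the positive reals this series must be the real
exponential series, so that S(n, 1) = 1 ([stirling2_1]), and then the hypothesis
at y = x t is the expansion sought ([expands_cexpZ]). *)

(** * Polynomials modulo a power of the variable *)

Lemma dvdXnP (F : fieldType) (N : nat) (p : {poly F}) :
  reflect (forall i, (i < N)%N -> p`_i = 0) ('X^N %| p).
Proof.
apply: (iffP idP) => [/dvdpP[q ->] i iN|p0].
  by rewrite coefMXn iN.
rewrite -[p](poly_take_drop N) (_ : take_poly N p = 0).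
  by rewrite add0r dvdp_mulIr.
apply/polyP => i; rewrite coef_take_poly coef0.
by case: ifP => // /p0.
Qed.

(** * Coefficients of powers and Bell polynomials *)

Lemma natr_fact_neq0 (F : numFieldType) (n : nat) : (n`!)%:R != 0 :> F.
Proof. by rewrite pnatr_eq0 -lt0n fact_gt0. Qed.

Lemma natr_bin (F : numFieldType) (n m : nat) : (m <= n)%N ->
  ('C(n, m))%:R = (n`!)%:R / ((m`!)%:R * ((n - m)`!)%:R) :> F.
Proof.
move=> mn; rewrite -(bin_fact mn) !natrM mulfK// mulf_neq0//; exact: natr_fact_neq0.
Qed.

(** The multinomial theorem in the form exp(u_1 Y) ... exp(u_m Y) =
exp((u_1 + ... + u_m) Y), read off at Y^k.  Cutting each exponential after Y^n
does not change the coefficients up to Y^n, which is why the bound [k <= n]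
appears; the truncation at the same [n] as in [bell] lets the expanded product
run over exactly the index functions of [bell]. *)
Lemma coef_prod_exp (F : numFieldType) (n m : nat) (u : 'I_m -> {poly F}) (k : nat) :
  (k <= n)%N ->
  (\prod_i \poly_(j < n.+1) ((j`!)%:R^-1 *: u i ^+ j))`_k
  = (k`!)%:R^-1 *: (\sum_i u i) ^+ k.
Proof.
move: k.
(* K p v: p agrees with exp(v Y) up to Y^n; it is stable under products. *)
pose K (p : {poly {poly F}}) (v : {poly F}) :=
  forall k, (k <= n)%N -> p`_k = (k`!)%:R^-1 *: v ^+ k.
apply: (big_ind2 K).
- by case=> [|k] _; rewrite coef1 ?invr1 ?scale1r ?expr0// expr0n scaler0.
- move=> p1 v1 p2 v2 K1 K2 k kn.
  rewrite coefM addrC exprDn scaler_sumr; apply: eq_bigr => -[j /= jk] _.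
  rewrite ltnS in jk.
  rewrite K1 ?(leq_trans jk)// K2 ?(leq_trans (leq_subr _ _))//.
  rewrite -scalerAl -scalerAr scalerA -scaler_nat scalerA.
  rewrite [v1 ^+ j * _]mulrC; congr (_ *: _).
  rewrite natr_bin//; field.
  by rewrite !natr_fact_neq0.
- by move=> i _ k kn; rewrite coef_poly ltnS kn.
Qed.

(** Expanding the product of the exponentials of (lambda_i / i!) X^i Y, each
index function contributes one monomial X^(sum i l_i) Y^(sum l_i); the two
conditions in [bell] select X^n Y^k. *)
Lemma coef_exp_bell (F : numFieldType) (n k : nat) (lam : nat -> F) :
  (k <= n)%N ->
  ((\sum_(i < n - k + 1) (lam i.+1 / (i.+1`!)%:R) *: 'X^(i.+1)) ^+ k)`_n
  = (k`!)%:R / (n`!)%:R * bell n k lam.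
Proof.
move=> kn; set m := (n - k + 1)%N.
pose u (i : 'I_m) : {poly F} := (lam i.+1 / (i.+1`!)%:R) *: 'X^(i.+1).
have := congr1 (fun p : {poly F} => (k`!)%:R * p`_n) (coef_prod_exp u kn).
rewrite coefZ mulrA divff ?natr_fact_neq0// mul1r => <-.
under eq_bigr do rewrite poly_def.
rewrite bigA_distr_bigA /= coef_sum coef_sum.
rewrite /bell -/m !mulr_sumr [RHS]big_mkcond /=.
apply: eq_bigr => l _.
have -> : \prod_(i < m) (((l i)`!%:R^-1 *: u i ^+ l i) *: 'X^(l i)) =
  ((\prod_(i < m) (l i)`!)%:R^-1 * \prod_(i < m) (lam i.+1 / (i.+1`!)%:R) ^+ l i) *:
     'X^(\sum_(i < m) i.+1 * l i)%N *: 'X^(\sum_(i < m) l i)%N :> {poly {poly F}}.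
  rewrite scaler_prod prodrXr scaler_prod prodfV -natr_prod; congr (_ *: _).
  rewrite -scalerA -prodrXr -scaler_prod; congr (_ *: _); apply: eq_bigr => i _.
  by rewrite exprZn exprM.
rewrite coefZ coefXn mulr_natr [k == _]eq_sym.
case: (_ == k) => /=; last by rewrite andbF mulr0n coef0 mulr0.
rewrite mulr1n coefZ coefXn [n == _]eq_sym andbT.
case: (_ == n) => /=; last by rewrite !mulr0.
rewrite mulr1; field.
rewrite !natr_fact_neq0 pnatr_eq0 -lt0n prodn_gt0// => i; exact: fact_gt0.
Qed.

(** * Inverting a series with constant term 1 *)

Lemma coef_trunc_sum (F : nzRingType) (c : nat -> F) (m i : nat) :
  (\sum_(j < m) c j.+1 *: 'X^(j.+1))`_i =
  if (0 < i <= m)%N then c i else 0.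
Proof.
rewrite coef_sum; under eq_bigr do rewrite coefZ coefXn mulr_natr mulrb eq_sym.
rewrite -big_mkcond /=; case: i => [|i]; first by rewrite big_pred0.
case: ifPn => /= [im|im]; first by rewrite (big_pred1 (Ordinal im)).
by rewrite big_pred0// => j; apply: contraNF im => /eqP[<-]; exact: ltn_ord.
Qed.

(** Every term of p^k - q^k = (p - q) (p^(k-1) + ... + q^(k-1)) gains k - 1
factors X besides those of p - q.  This is why only lambda_1, ...,
lambda_(n-k+1) enter the coefficient of X^n in a k-th power. *)
Lemma dvdXn_subX (F : fieldType) (m k : nat) (p q : {poly F}) :
  'X %| p -> 'X %| q -> 'X^(m.+1) %| p - q -> 'X^(m + k) %| p ^+ k - q ^+ k.
Proof.
case: k => [|k] Xp Xq Xpq; first by rewrite subrr dvdp0.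
rewrite -addSnnS exprD subrXX dvdp_mul//.
apply: (big_ind (fun r => 'X^k %| r)) => [||i _] /=; first exact: dvdp0.
  by move=> ? ? ? ?; rewrite dvdp_addl.
rewrite -{1}(subnK (ltnSE (ltn_ord i))).
by rewrite exprD dvdp_mul// dvdp_exp2r.
Qed.

(** With v = w - 1, the inverse of w modulo X^(n+1) is the geometric sum g of
the powers of -v, since v is divisible by X. *)
Lemma coef_inverse_bell (F : numFieldType) (n : nat) (lam : nat -> F)
    (b w : {poly F}) :
  w`_0 = 1 -> (forall i, (0 < i <= n)%N -> w`_i = lam i / (i`!)%:R) ->
  'X^(n.+1) %| b * w - 1 ->
  (n`!)%:R * b`_n = \sum_(0 <= k < n.+1) (-1) ^+ k * (k`!)%:R * bell n k lam.
Proof.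
move=> w0 wE Xbw; set v := w - 1.
have Xv : 'X %| v.
  by rewrite -['X]expr1; apply/dvdXnP => -[|//] _; rewrite coefB coef1 w0 subrr.
pose g := \sum_(k < n.+1) (- v) ^+ k.
have Xbg : 'X^(n.+1) %| b - g.
  have -> : b - g = (b * w - 1) * g + b * (- v) ^+ n.+1.
    have := subrX1 (- v) n.+1; rewrite -/g => /(canRL (subrK 1)) ->.
    by rewrite /v; ring.
  by rewrite dvdp_addl; [exact: dvdp_mulr|rewrite dvdp_mull// dvdp_exp2r// dvdpNr].
move/dvdXnP: Xbg => /(_ n (ltnSn n)); rewrite coefB => /eqP; rewrite subr_eq0 => /eqP ->.
rewrite /g coef_sum mulr_sumr big_mkord; apply: eq_bigr => -[k /= kn] _.
rewrite ltnS in kn.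
have -> : ((- v) ^+ k)`_n = (-1) ^+ k * (v ^+ k)`_n.
  by rewrite -scaleN1r exprZn coefZ.
(* v' is v without the terms that cannot reach X^n in a k-th power. *)
pose v' : {poly F} := \sum_(i < n - k + 1) (lam i.+1 / (i.+1`!)%:R) *: 'X^(i.+1).
have v'E i : v'`_i = if (0 < i <= n - k + 1)%N then lam i / (i`!)%:R else 0.
  exact: (coef_trunc_sum (fun i => lam i / (i`!)%:R)).
have -> : (v ^+ k)`_n = (v' ^+ k)`_n.
  have [->|k0] := posnP k; first by rewrite !expr0.
  apply/eqP; rewrite -subr_eq0 -coefB; apply/eqP.
  suff : 'X^(n - k + 1 + k) %| v ^+ k - v' ^+ k.
    by move/dvdXnP; apply; rewrite addn1 addSn subnK.
  apply: dvdXn_subX => //.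
    by rewrite -['X]expr1; apply/dvdXnP => -[|//] _; rewrite v'E.
  apply/dvdXnP => -[|i] im; rewrite coefB v'E /=; first by rewrite coefB coef1 w0 !subrr.
  rewrite coefB coef1 /= subr0 -ltnS im wE ?subrr//=.
  by rewrite (leq_trans (ltnSE im))// addn1 ltn_subrL k0 (leq_trans k0).
rewrite coef_exp_bell//; field; exact: natr_fact_neq0.
Qed.

(** * Asymptotic expansions at 0 from the right *)

Section Expansions.
Import numFieldNormedType.Exports.
Local Open Scope classical_set_scope.
Variable K : numFieldType.
Implicit Types (f g : K -> K) (p q : {poly K}).

(** In an arbitrary number field, t -> 0+ forces t to be a positive real; one
side of the real axis is enough to determine the coefficients, and it spares
all absolute values of t. *)
Definition expands (N : nat) f p : Prop :=
  exists2 C : K, 0 <= C & \forall t \near 0^'+, `|f t - p.[t]| <= C * t ^+ N.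

Lemma poly_bounded p :
  exists2 C : K, 0 <= C & \forall t \near 0^'+, `|p.[t]| <= C.
Proof.
exists (\sum_(i < size p) `|p`_i|); first exact: sumr_ge0.
near=> t; rewrite horner_coef (le_trans (ler_norm_sum _ _ _))// ler_sum// => i _.
have t0 : 0 < t by near: t; exact: nbhs_right_gt.
have t1 : t <= 1 by near: t; apply: nbhs_right_ltW.
by rewrite normrM normrX (gtr0_norm t0) ler_piMr// exprn_ile1// ltW.
Unshelve. all: by end_near. Qed.

(** From f g - p q = (f - p) g + p (g - q), where g and p stay bounded. *)
Lemma expandsM N f g p q :
  expands N f p -> expands N g q -> expands N (fun t => f t * g t) (p * q).
Proof.
move=> [C C0 fp] [D D0 gq]; have [P P0 pP] := poly_bounded p.
have [Q Q0 qQ] := poly_bounded q.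
exists (C * (D + Q) + P * D); first by rewrite !(addr_ge0, mulr_ge0).
near=> t.
have t0 : 0 < t by near: t; exact: nbhs_right_gt.
have t1 : t <= 1 by near: t; apply: nbhs_right_ltW.
have tN0 : 0 <= t ^+ N by rewrite exprn_ge0// ltW.
have fpt : `|f t - p.[t]| <= C * t ^+ N by near: t.
have gqt : `|g t - q.[t]| <= D * t ^+ N by near: t.
have pt : `|p.[t]| <= P by near: t.
have qt : `|q.[t]| <= Q by near: t.
have gt : `|g t| <= D + Q.
  rewrite -[g t](subrK q.[t]) (le_trans (ler_normD _ _))// lerD//.
  by rewrite (le_trans gqt)// ler_piMr// exprn_ile1// ltW.
have -> : f t * g t - (p * q).[t] = (f t - p.[t]) * g t + p.[t] * (g t - q.[t]).
  by rewrite hornerM; ring.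
rewrite (le_trans (ler_normD _ _))// !normrM mulrDl lerD//.
  by rewrite mulrAC ler_pM.
by rewrite -mulrA ler_pM.
Unshelve. all: by end_near. Qed.

Lemma expands_horner N p : expands N (fun t => p.[t]) p.
Proof.
by exists 0 => //; near=> t; rewrite subrr normr0 mul0r.
Unshelve. all: by end_near. Qed.

Lemma expandsX N k f p : expands N f p -> expands N (fun t => f t ^+ k) (p ^+ k).
Proof.
move=> fp; elim: k => [|k IH].
  have [C C0 H] := expands_horner N 1; exists C => //.
  near=> t; rewrite expr0 -[X in X - _](hornerC 1 t); near: t; exact: H.
have [C C0 H] := expandsM fp IH; exists C => //.
by near=> t; rewrite !exprS; near: t.
Unshelve. all: by end_near. Qed.

Lemma expandsD N f g p q :
  expands N f p -> expands N g q -> expands N (fun t => f t + g t) (p + q).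
Proof.
move=> [C C0 fp] [D D0 gq]; exists (C + D); first exact: addr_ge0.
near=> t.
have fpt : `|f t - p.[t]| <= C * t ^+ N by near: t.
have gqt : `|g t - q.[t]| <= D * t ^+ N by near: t.
by rewrite hornerD opprD addrACA (le_trans (ler_normD _ _))// mulrDl lerD.
Unshelve. all: by end_near. Qed.

Lemma expands_near N f g p : (\forall t \near 0^'+, f t = g t) ->
  expands N f p -> expands N g p.
Proof.
move=> fg [C C0 fp]; exists C => //; near=> t.
have <- : f t = g t by near: t.
by near: t.
Unshelve. all: by end_near. Qed.

(** By induction p = q X^N, and dividing the bound by t^N leaves q(t) = O(t),
which forces the constant term of q to vanish. *)
Lemma dvdXn_small N p (C : K) : 0 <= C ->
  (\forall t \near 0^'+, `|p.[t]| <= C * t ^+ N) -> 'X^N %| p.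
Proof.
elim: N => [|N IH] in p C *; first by rewrite dvd1p.
move=> C0 pC; have /dvdpP[q pq] : 'X^N %| p.
  apply: (IH _ C) => //; near=> t.
  have t0 : 0 < t by near: t; exact: nbhs_right_gt.
  have t1 : t <= 1 by near: t; apply: nbhs_right_ltW.
  have pt : `|p.[t]| <= C * t ^+ N.+1 by near: t.
  by rewrite (le_trans pt)// ler_wpM2l// exprS ler_piMl// exprn_ge0// ltW.
rewrite pq exprS dvdp_mul2r ?monic_neq0 ?monicXn//.
suff q00 : q`_0 = 0.
  by rewrite -['X]expr1; apply/dvdXnP => -[|//] _.
have /dvdpP[q1 q1E] : 'X %| q - (q`_0)%:P.
  by rewrite -['X]expr1; apply/dvdXnP => -[|//] _; rewrite coefB coefC subrr.
have [Q Q0 qQ] := poly_bounded q1.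
apply/eqP; apply: contraT => c0.
have D0 : 0 < C + Q + 1 by rewrite ltr_wpDl// addr_ge0.
suff : \forall t \near (0 : K)^'+, False by move/filter_ex => [].
near=> t.
have t0 : 0 < t by near: t; exact: nbhs_right_gt.
have : t < `|q`_0| / (C + Q + 1).
  by near: t; apply: nbhs_right_lt; rewrite divr_gt0// normr_gt0.
rewrite ltr_pdivlMr// => tc.
have pt : `|p.[t]| <= C * t ^+ N.+1 by near: t.
have qt : `|q1.[t]| <= Q by near: t.
have {pt}pt : `|q.[t]| <= C * t.
  move: pt; rewrite pq hornerM hornerXn normrM normrX (gtr0_norm t0) exprS mulrA.
  by rewrite ler_pM2r// exprn_gt0.
have : `|q`_0| <= (C + Q) * t.
  have -> : q`_0 = q.[t] - q1.[t] * t.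
    move/(congr1 (fun r => r.[t])): q1E; rewrite hornerM hornerX hornerD hornerN hornerC.
    by move=> <-; ring.
  rewrite (le_trans (ler_normB _ _))// normrM (gtr0_norm t0) mulrDl lerD//.
  by rewrite ler_pM2r.
by move=> /(lt_le_trans tc); rewrite mulrC ltr_pM2r// gtrDl ltr10.
Unshelve. all: by end_near. Qed.

Lemma expands_inj N f p q :
  expands N f p -> expands N f q -> 'X^N %| p - q.
Proof.
move=> [C C0 fp] [D D0 fq]; apply: (@dvdXn_small _ _ (C + D)); first exact: addr_ge0.
near=> t; rewrite hornerD hornerN.
have -> : p.[t] - q.[t] = (f t - q.[t]) - (f t - p.[t]) by ring.
rewrite (le_trans (ler_normB _ _))// addrC mulrDl lerD//; near: t.
Unshelve. all: by end_near. Qed.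

(** Convergence at one point s > 0 bounds all terms c_k s^k by some M, so for
t < s / 2 the tail from N on is at most M (t / s)^N times a geometric series
of ratio below 1 / 2. *)
Lemma expands_series N (r : K) (c : nat -> K) f : 0 < r ->
  (forall t, 0 < t -> t < r ->
    (fun M => \sum_(0 <= k < M) c k * t ^+ k) @ \oo --> f t) ->
  expands N f (\poly_(k < N) c k).
Proof.
move=> r0 cf; have [s s0 sr] : exists2 s, 0 < s & s < r.
  by exists (r / 2); rewrite ?divr_gt0// ltr_pdivrMr// ltr_pMr// ltr1n.
have [M M0 cM] : exists2 M : K, 0 <= M & forall k, `|c k * s ^+ k| <= M.
  have /cvgP/cvg_seq_bounded/pinfty_ex_gt0[M M0 SM] := cf _ s0 sr.
  exists (M + M) => [|k]; first by rewrite addr_ge0// ltW.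
  have -> : c k * s ^+ k =
      \sum_(0 <= j < k.+1) c j * s ^+ j - \sum_(0 <= j < k) c j * s ^+ j.
    by rewrite big_nat_recr//= addrAC subrr add0r.
  by rewrite (le_trans (ler_normB _ _))// lerD//; exact: SM.
exists (2 * M / s ^+ N).
  by rewrite !mulr_ge0// invr_ge0 exprn_ge0// ltW.
near=> t.
have t0 : 0 < t by near: t; exact: nbhs_right_gt.
have ts : t < s / 2 by near: t; apply: nbhs_right_lt; rewrite divr_gt0.
have tr : t < r.
  by rewrite (lt_trans _ sr)// (lt_trans ts)// ltr_pdivrMr// ltr_pMr// ltr1n.
set u := t / s.
have u0 : 0 < u by rewrite divr_gt0.
have u2 : u * 2 < 1 by rewrite /u mulrAC ltr_pdivrMr// mul1r -ltr_pdivlMr.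
have tail m : `|\sum_(0 <= k < N + m) c k * t ^+ k - (\poly_(k < N) c k).[t]|
    <= 2 * M / s ^+ N * t ^+ N.
  have -> : (\poly_(k < N) c k).[t] = \sum_(0 <= k < N) c k * t ^+ k.
    by rewrite horner_poly big_mkord.
  rewrite (big_cat_nat _ (n := N)) ?leq_addr//= addrAC subrr add0r.
  rewrite -{1}[N]add0n big_addn addKn.
  have -> : 2 * M / s ^+ N * t ^+ N = M * u ^+ N * 2.
    by rewrite /u expr_div_n; field; rewrite expf_neq0// gt_eqF.
  apply: (@le_trans _ _ (\sum_(0 <= k < m) M * u ^+ N * u ^+ k)).
    rewrite (le_trans (ler_norm_sum _ _ _))// ler_sum// => k _.
    rewrite -mulrA -exprD addnC -(divfK (lt0r_neq0 s0) t) -/u exprMn mulrCA mulrC.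
    rewrite normrM normrX (gtr0_norm u0) ler_pM2r ?exprn_gt0//; exact: cM.
  rewrite -mulr_sumr ler_wpM2l ?mulr_ge0 ?exprn_ge0 ?(ltW u0)//.
  elim: m => [|m IHm]; first by rewrite big_geq.
  rewrite big_nat_recl//= expr0.
  under eq_bigr do rewrite exprS.
  rewrite -mulr_sumr (le_trans (_ : _ <= 1 + u * 2))//.
    by rewrite lerD2l ler_pM2l.
  by rewrite [leRHS](_ : _ = 1 + 1)// lerD2l ltW.
apply/ler_addgt0Pr => e e0.
have /cvgrPdist_lt/(_ e e0) := cf _ t0 tr.
case=> m _ /(_ (N + m)%N (leq_addl _ _)) /= me.
rewrite -(subrK (\sum_(0 <= k < N + m) c k * t ^+ k) (f t)) -addrA.
by rewrite (le_trans (ler_normD _ _))// [leRHS]addrC lerD// ltW.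
Unshelve. all: by end_near. Qed.

End Expansions.

(** * The complex exponential and Stirling numbers *)

Section ComplexExponential.
Import numFieldNormedType.Exports.
Variable R : realType.

Lemma cexp_real (r : R) : cexp r%:C = (expR r)%:C.
Proof. by rewrite /cexp /= cos0 sin0 mulr0 addr0 mulr1. Qed.

Lemma cexp_neq1 (t : R[i]) : 0 < t -> cexp t != 1.
Proof.
case: t => r i; rewrite ltcE /= => /andP[/eqP-> r0].
by rewrite cexp_real -(rmorph1 (real_complex R)) (inj_eq (@complexI R)) gt_eqF// expR_gt1.
Qed.

Lemma cexpNM (z : R[i]) : cexp (- z) * cexp z = 1.
Proof.
case: z => u v; rewrite /cexp /= expRN cosN sinN; simpc.
have e0 := expR_gt0 u; have cs := cos2Dsin2 v.
apply/eqP; rewrite eq_complex /=; apply/andP; split; apply/eqP; last by ring.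
by rewrite -cs; field; rewrite gt_eqF.
Qed.

(** A positive element of R[i] is real, so this is the real exponential series
seen in R[i]. *)
Lemma ccvg_exp (t : R[i]) : 0 < t ->
  ccvg (fun M => \sum_(0 <= k < M) (k`!)%:R^-1 * t ^+ k) (cexp t).
Proof.
have cvg_exp (r : R) : (series (exp_coeff r) @ \oo --> expR r)%classic.
  exact: is_cvg_series_exp_coeff.
case: t => r i; rewrite ltcE /= => /andP[/eqP-> _]; rewrite cexp_real.
apply/cvgrPdist_lt => -[e i']; rewrite ltcE /= => /andP[/eqP-> e0].
have /cvgrPdist_lt/(_ e e0) := cvg_exp r; apply: filterS => M.
rewrite -ltcR; congr (_ < _).
have -> : \sum_(0 <= k < M) (k`!)%:R^-1 * (r +i* 0) ^+ k =
    (series (exp_coeff r) M)%:C.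
  rewrite /series /= rmorph_sum; apply: eq_bigr => k _.
  by rewrite /exp_coeff /= rmorphM fmorphV rmorph_nat rmorphXn mulrC.
by rewrite -rmorphB normc_def /= expr0n addr0 sqrtr_sqr.
Qed.

Lemma expands_cexp N : expands N (@cexp R) (\poly_(k < N) (k`!)%:R^-1).
Proof.
by apply: (@expands_series _ _ 1) => // t t0 _; exact: ccvg_exp.
Qed.

Lemma expands_cexpB1X N (k : nat) (S : nat -> nat -> R[i]) (z : R[i]) :
  is_stirling2 S -> (0 < k)%N ->
  expands N (fun t => (cexp (z * t) - 1) ^+ k / (k`!)%:R)
    (\poly_(n < N) (if (k <= n)%N then S n k * (z ^+ n / (n`!)%:R) else 0)).
Proof.
move=> hS k0; apply: (@expands_series _ _ 1) => // t t0 _.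
rewrite [X in (X @ _ --> _)%classic](_ : _ = fun M =>
    \sum_(k <= n < M) S n k * ((z * t) ^+ n / (n`!)%:R)); first exact: hS.
apply/funext => M.
rewrite [RHS](big_nat_widenl _ 0)// [RHS]big_mkcond /=; apply: eq_bigr => n _.
by case: ifP; rewrite ?mul0r// exprMn => _; ring.
Qed.

Lemma expands_cexp_stirling N (S : nat -> nat -> R[i]) (z : R[i]) :
  is_stirling2 S ->
  expands N (fun t => cexp (z * t))
    (\poly_(n < N) (if (0 < n)%N then S n 1%N * (z ^+ n / (n`!)%:R) else 0) + 1).
Proof.
move=> hS.
have := expandsD (expands_cexpB1X N z hS (isT : (0 < 1)%N)) (expands_horner N 1).
apply: expands_near; apply: nearW => t.
by rewrite expr1 factS fact0 muln1 divr1 hornerC subrK.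
Qed.

(** The defining series for k = 1 and the real exponential series expand the
same function, so they have the same coefficients. *)
Lemma stirling2_1 (S : nat -> nat -> R[i]) n :
  is_stirling2 S -> (0 < n)%N -> S n 1%N = 1.
Proof.
move=> hS n0; have := expands_cexp_stirling n.+1 1 hS.
under [X in expands _ X]eq_fun do rewrite mul1r.
move/expands_inj/(_ (expands_cexp _))/dvdXnP/(_ n (ltnSn n)).
rewrite coefB coefD coef1 !coef_poly ltnSn n0 gtn_eqF//= addr0 expr1n mul1r.
move/eqP; rewrite subr_eq0 => /eqP; rewrite -[RHS]mul1r; apply: mulIf.
by rewrite invr_eq0 natr_fact_neq0.
Qed.

(** With S(n, 1) = 1, the defining series for k = 1 at y = x t is the exponential
series at x t.  The order is positive so that the constant term 1 is not cut
off. *)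
Lemma expands_cexpZ N (S : nat -> nat -> R[i]) (x : R[i]) :
  is_stirling2 S ->
  expands N.+1 (fun t => cexp (x * t)) (\poly_(k < N.+1) (x ^+ k / (k`!)%:R)).
Proof.
move=> hS; have := expands_cexp_stirling N.+1 x hS.
congr expands; apply/polyP => k; rewrite coefD coef1 !coef_poly.
case: k => [|k]; first by rewrite /= add0r expr0 divr1.
by case: ifP; rewrite addr0// stirling2_1// mul1r.
Qed.

End ComplexExponential.

(** * The explicit formula *)

Theorem theorem2 (R : realType) (a n : nat) (x : R[i])
    (B : nat -> R[i] -> R[i]) (S : nat -> nat -> R[i])
    (ha : (1 <= a)%N)
    (hB : is_generalized_bernoulli a B)
    (hS : is_stirling2 S) :
  B n (- x) =
    \sum_(0 <= k < n.+1) (-1) ^+ k * (k`!)%:R * bell n k (bell_arg S a x).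
Proof.
(* Dividing by t^a costs a coefficients, hence the truncation at degree a + n
   instead of n; U is the truncation of (e^t - 1) / t. *)
pose m := (a + n)%N; pose N := m.+1.
pose PB := \poly_(k < N) (B k (- x) / (k`!)%:R).
pose PE := \poly_(k < N) (x ^+ k / (k`!)%:R).
pose U : {poly R[i]} := \poly_(k < m) (k.+1`!)%:R^-1.
have eB : expands N (fun t => bernoulli_factor t ^+ a * cexp (- (x * t))) PB.
  apply: (@expands_series _ _ ((2 * pi)%:C)) => [|t t0 t2].
    by rewrite ltcR mulr_gt0// pi_gt0.
  by apply: hB; rewrite gtr0_norm.
have eE : expands N (fun t => cexp (x * t)) PE by exact: expands_cexpZ hS.
have e1 : expands N (fun t => cexp t - 1) ('X * U).
  have := expandsD (expands_cexp R N) (expands_horner N (-1)).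
  under [X in expands _ X]eq_fun do rewrite hornerN hornerC.
  congr expands; apply/polyP => k; rewrite coefD coefN coef1 coefXM !coef_poly.
  by case: k => [|k] /=; rewrite ?invr1 ?subrr// subr0.
have eXU := expandsX a e1; rewrite exprMn in eXU.
(* (e^t - 1)^a is expanded both as the a-th power of X U and by the
   hypothesis on S; comparing the coefficients of X^(l + a) gives S in terms
   of U. *)
have SU l : (l <= n)%N -> (U ^+ a)`_l = (a`!)%:R * S (l + a)%N a / ((l + a)`!)%:R.
  move=> ln.
  have := expandsM (expands_horner N ((a`!)%:R)%:P) (expands_cexpB1X N 1 hS ha).
  have fE t : (((a`!)%:R)%:P).[t] * ((cexp (1 * t) - 1) ^+ a / (a`!)%:R) =
      (cexp t - 1) ^+ a :> R[i].
    by rewrite hornerC mul1r mulrCA divff ?mulr1// natr_fact_neq0.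
  under [X in expands _ X]eq_fun do rewrite fE.
  have lN : (l + a < N)%N by rewrite ltnS addnC leq_add2l.
  move/expands_inj/(_ eXU)/dvdXnP/(_ _ lN)/eqP; rewrite coefB subr_eq0 => /eqP.
  rewrite coefXnM coefCM coef_poly lN leq_addl ltnNge leq_addl /= addnK => <-.
  by rewrite expr1n mul1r mulrA.
(* The product of the three functions is t^a, because the exponentials of
   x t and - x t cancel; X^a is then cancelled on both sides. *)
have Xinv : 'X^(n.+1) %| PB * (U ^+ a * PE) - 1.
  have Xa := expands_horner N ('X^a : {poly R[i]}).
  have : expands N (fun t => ('X^a : {poly R[i]}).[t]) (PB * ('X^a * U ^+ a) * PE).
    apply: (expands_near _ (expandsM (expandsM eB eXU) eE)).
    near=> t.
    have t0 : 0 < t by near: t; exact: nbhs_right_gt.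
    have c1 : cexp t - 1 != 0 by rewrite subr_eq0 cexp_neq1.
    rewrite hornerXn /bernoulli_factor gt_eqF// expr_div_n.
    rewrite -[RHS]mulr1 -[X in _ = _ * X](cexpNM (x * t)).
    by field; rewrite expf_neq0.
  move/expands_inj/(_ Xa).
  have -> : PB * ('X^a * U ^+ a) * PE - 'X^a = 'X^a * (PB * (U ^+ a * PE) - 1).
    by ring.
  by rewrite /N /m -addnS exprD dvdp_mul2l// monic_neq0// monicXn.
have := coef_inverse_bell _ _ Xinv.
rewrite coef_poly ltnS leq_addl mulrCA divff ?natr_fact_neq0// mulr1; apply.
- have m0 : (0 < m)%N by rewrite addn_gt0 ha.
  rewrite -horner_coef0 hornerM horner_exp !horner_coef0 !coef_poly m0 /=.
  by rewrite invr1 expr1n expr0 !mulr1.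
- move=> i /andP[i0 im]; rewrite coefM /bell_arg big_mkord mulr_suml.
  apply: eq_bigr => -[j /= ji] _; rewrite ltnS in ji.
  rewrite SU ?(leq_trans ji)// coef_poly ifT; last first.
    by rewrite ltnS (leq_trans (leq_subr _ _))// (leq_trans im)// leq_addl.
  rewrite !natr_bin ?leq_addl// addnK; field.
  by rewrite !natr_fact_neq0.
Unshelve. all: by end_near. Qed.
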